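(* Let $\mathbb{P}$ be a Datalog program and $\mathcal{I}$ a database instance. Suppose $i$ steps of one-rule-per-step semi-naive evaluation have been performed, that the rule $$r=\ p(\vec t)\leftarrow e_1(\vec{t_1}),\ldots,e_n(\vec{t_n}),q_1(\vec{s_1}),\ldots,q_m(\vec{s_m})$$ of $\mathbb{P}$ (with $e_1,\ldots,e_n$ EDB predicates and $p,q_1,\ldots,q_m$ IDB predicates) is to be applied in step $i+1$, and that $j<i+1$ was the last step in which $r$ was applied. Fix $\ell\in\{1,\ldots,m\}$ and consider the join $$J=R_{\mathsf{EDB}}\bowtie\Delta_{q_1}^{[l_1,u_1]}(\vec{s_1})\bowtie\cdots\bowtie\Delta_{q_m}^{[l_m,u_m]}(\vec{s_m}),$$ where $[l_b,u_b]=[0,i]$ for $b<\ell$, $[l_\ell,u_\ell]=[j,i]$, and $[l_b,u_b]=[0,j-1]$ for $b>\ell$. Let $k\in\{1,\ldots,m\}$, let $$R_k=R_{\mathsf{EDB}}\bowtie\Delta_{q_1}^{[l_1,u_1]}(\vec{s_1})\bowtie\cdots\bowtie\Delta_{q_{k-1}}^{[l_{k-1},u_{k-1}]}(\vec{s_{k-1}}),$$ and let $o\in[l_k,u_k]$ be a step with $\Delta_{q_k}^o\neq\emptyset$, in which the rule $\mathsf{rule}[o]$ was applied. If, for all $\sigma\in R_k$, the atom $q_k(\vec{s_k})\sigma$ does not unify with the head of $\mathsf{rule}[o]$, then the result of the join $J$ remains the same when the relation $\Delta_{q_k}^{[l_k,u_k]}$ in its $k$-th IDB position is replaced by $\Del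ta_{q_k}^{[l_k,u_k]}\setminus\Delta_{q_k}^o$.
   Context: **Datalog.** Terms are constants or variables; an atom is $p(\vec t)$ with $|\vec t|$ equal to the arity of $p$; a fact is a variable-free atom; a database instance is a finite set of facts. A rule is an expression $H\leftarrow B_1,\ldots,B_n$ with head atom $H$ and body atoms $B_1,\ldots,B_n$, assumed safe: every variable of $H$ occurs in some $B_i$. A program $\mathbb{P}$ is a finite set of rules. Predicates occurring in the head of some rule are IDB predicates; all others are EDB predicates. IDB predicates do not occur in $\mathcal{I}$. A substitution is a partial map from variables to constants and variables. **One-rule-per-step semi-naive evaluation.** In each step $i\geq 1$ a single rule $\mathsf{rule}[i]\in\mathbb{P}$ is applied. For each IDB predicate $p$, $\Delta_p^i$ denotes the set of new $p$-facts derived in step $i$; $\Delta_p^0=\emptyset$, and $\Delta_p^i=\emptyset$ if $p$ is not the head predicate of $\mathsf{rule}[i]$. Write $\Delta_p^{[a,b]}=\bigcup_{k=a}^b\Delta_p^k$ (empty if $a>b$). Suppose steps $1,\ldots,i$ have been performed and $\mathsf{rule}[i+1]=r$, with $r= p(\vec t)\leftarrow e_1(\vec{t_1}),\ldots,e_n(\vec{t_n}),q_1(\vec{s_1}),\ldots,q_m(\vec{s_m})$, where $e_1,\ldots,e_n$ are EDB predicates and $p,q_1,\ldots,q_m$ are IDB predicates. - If $r$ has not been applied in any of the steps $1,\ldots,i$, let $\mathrm{tmp}_p$ be the set of all facts $p(\vec t)\sigma$ such that $e_a(\vec{t_a})\sigma\in\mathcal{I}$ for all $a$ and $q_b(\vec{s_b})\sigma\in\Delta^{[0,i]}_{q_b}$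 for all $b$. - If $r$ was last applied in step $j$ with $1\le j\le i$, let $\mathrm{tmp}_p$ be the union over all $\ell\in\{1,\ldots,m\}$ of the sets of all facts $p(\vec t)\sigma$ such that $e_a(\vec{t_a})\sigma\in\mathcal{I}$ for all $a$, $q_b(\vec{s_b})\sigma\in\Delta_{q_b}^{[0,i]}$ for all $b<\ell$, $q_\ell(\vec{s_\ell})\sigma\in\Delta_{q_\ell}^{[j,i]}$, and $q_b(\vec{s_b})\sigma\in\Delta_{q_b}^{[0,j-1]}$ for all $b>\ell$. In both cases $\Delta_p^{i+1}=\mathrm{tmp}_p\setminus\Delta_p^{[0,i]}$. **Joins as sets of substitutions.** $R_{\mathsf{EDB}}$ is the join of the EDB atoms of $r$ over $\mathcal{I}$: the set of substitutions $\sigma$ mapping exactly the variables of $\vec{t_1},\ldots,\vec{t_n}$ to constants such that $e_a(\vec{t_a})\sigma\in\mathcal{I}$ for all $a$. For sets $D_1,\ldots,D_h$ of facts, $R_{\mathsf{EDB}}\bowtie D_1(\vec{s_1})\bowtie\cdots\bowtie D_h(\vec{s_h})$ is the set of substitutions $\sigma$ mapping exactly the variables of $\vec{t_1},\ldots,\vec{t_n},\vec{s_1},\ldots,\vec{s_h}$ to constants such that $e_a(\vec{t_a})\sigma\in\mathcal{I}$ for all $a$ and $q_b(\vec{s_b})\sigma\in D_b$ for all $b\le h$. Thus $R_k$ is a set of partial substitutions for the variables of $r$. **Unification.** Two atoms unify if some substitution makes them equal. When asking whether an atom of $r$ (or an instance of it) unifies with the head of $\mathsf{rule}[o]$, the variables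 of $\mathsf{rule}[o]$ are first renamed so that they are disjoint from those of $r$. *)

(* Defs.v *)
From HB Require Import structures.
From mathcomp Require Import all_boot finmap.
From mathcomp Require Import boolp classical_sets functions cardinality.

Set Implicit Arguments.
Unset Strict Implicit.
Unset Printing Implicit Defensive.

Local Open Scope classical_set_scope.

Section Syntax.
Variables (Const Var Pred : choiceType) (arity : Pred -> nat).

(* [inl c] is the constant c, [inr x] the variable x. *)
Definition term := (Const + Var)%type.
HB.instance Definition _ := Choice.on term.

Definition atom := {p : Pred & (arity p).-tuple term}.
HB.instance Definition _ := Choice.on atom.

Definition pred_of (a : atom) : Pred := tag a.

Definition args (a : atom) : seq term := tagged a.

Definition atom_vars (a : atom) : seq Var :=
  pmap (fun t : term => if t is inr x then Some x else None) (args a).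

Definition is_fact (a : atom) : Prop := atom_vars a = [::].

(* head, body *)
Definition rule := (atom * seq atom)%type.
HB.instance Definition _ := Choice.on rule.

Definition head (r : rule) : atom := r.1.
Definition body (r : rule) : seq atom := r.2.

Definition atoms_vars (s : seq atom) : seq Var := flatten (map atom_vars s).

Definition rule_vars (r : rule) : seq Var := atoms_vars (head r :: body r).

Definition safe (r : rule) : Prop :=
  {subset atom_vars (head r) <= atoms_vars (body r)}.

Definition datalog_program (P : {fset rule}) : Prop :=
  forall r, r \in P -> safe r.

Definition is_idb (P : {fset rule}) (p : Pred) : bool :=
  has (fun r => pred_of (head r) == p) P.

(* An instance over which P can be evaluated: IDB predicates do not occur. *)
Definition database_instance (P : {fset rule}) (I : {fset atom}) : Prop :=
  forall f, f \in I -> is_fact f /\ ~~ is_idb P (pred_of f).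

(* The body of a rule is split into its EDB atoms e_1(t_1), ..., e_n(t_n) and
   its IDB atoms q_1(s_1), ..., q_m(s_m), each in the order of the body. *)
Definition edb_atoms (P : {fset rule}) (r : rule) : seq atom :=
  [seq a <- body r | ~~ is_idb P (pred_of a)].

Definition idb_atoms (P : {fset rule}) (r : rule) : seq atom :=
  [seq a <- body r | is_idb P (pred_of a)].

(* Positions of IDB atoms are counted from 0: [idb_atom P r b] is
   q_{b+1}(s_{b+1}). *)
Definition idb_atom (P : {fset rule}) (r : rule)
    (b : 'I_(size (idb_atoms P r))) : atom :=
  tnth (in_tuple (idb_atoms P r)) b.

Definition substitution := Var -> option term.

Definition subst_term (s : substitution) (t : term) : term :=
  match t with
  | inl c => inl c
  | inr x => odflt (inr x) (s x)
  end.

Definition subst_atom (s : substitution) (a : atom) : atom :=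
  Tagged (fun p => (arity p).-tuple term)
    (map_tuple (subst_term s) (tagged a)).

Definition maps_exactly_to_constants (s : substitution) (xs : seq Var) : Prop :=
  forall x, if x \in xs then exists c : Const, s x = Some (inl c)
            else s x = None.

Definition unify (a b : atom) : Prop :=
  exists s : substitution, subst_atom s a = subst_atom s b.

Definition rename_atom (rho : Var -> Var) : atom -> atom :=
  subst_atom (fun x => Some (inr (rho x))).

Definition renames_apart (rho : Var -> Var) (r' r : rule) : Prop :=
  {in rule_vars r' &, injective rho} /\
  (forall x, x \in rule_vars r' -> rho x \notin rule_vars r).

(* a, an instance of an atom of r, unifies with the head of r' once the
   variables of r' have been renamed apart from those of r.  The choice of the
   renaming is immaterial; one exists when Var is infinite. *)
Definition unifies_with_head (r : rule) (a : atom) (r' : rule) : Prop :=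
  exists2 rho, renames_apart rho r' r & unify a (rename_atom rho (head r')).

(* The join of the atoms es over I and of D_0(q_0), ..., D_{h-1}(q_{h-1}). *)
Definition join (I : {fset atom}) (es : seq atom) (m : nat)
    (q : 'I_m -> atom) (D : 'I_m -> set atom) (h : nat) : set substitution :=
  [set s | [/\ maps_exactly_to_constants s
                 (atoms_vars (es ++ [seq q b | b : 'I_m <- enum 'I_m & b < h])),
               forall e, e \in es -> subst_atom s e \in I
             & forall b : 'I_m, b < h -> D b (subst_atom s (q b))]].

End Syntax.

Section Evaluation.
Variables (Const Var Pred : choiceType) (arity : Pred -> nat).
Local Notation atom := (atom Const Var arity).
Local Notation rule := (rule Const Var arity).
Variables (P : {fset rule}) (I : {fset atom}).

(* [rule_at i] is the rule applied in step i >= 1 (its value at 0 is never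
   used) and [Delta i p] is the set of new p-facts derived in step i. *)
Variables (rule_at : nat -> rule) (Delta : nat -> Pred -> set atom).

Definition Delta_range (p : Pred) (a b : nat) : set atom :=
  \bigcup_(k in [set k | a <= k <= b]) Delta k p.

Definition never_applied (r : rule) (i : nat) : Prop :=
  forall k, 1 <= k <= i -> rule_at k <> r.

Definition last_applied (r : rule) (i j : nat) : Prop :=
  [/\ 1 <= j <= i, rule_at j = r & forall k, j < k <= i -> rule_at k <> r].

(* Facts derived by r when its b-th IDB atom is matched against D b. *)
Definition derived (r : rule) (D : 'I_(size (idb_atoms P r)) -> set atom) :
    set atom :=
  [set f | is_fact f /\
    exists s : substitution Const Var,
      [/\ f = subst_atom s (head r),
          forall e, e \in edb_atoms P r -> subst_atom s e \in I
        & forall b, D b (subst_atom s (idb_atom b))]].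

(* The bounds [l_b, u_b] of the semi-naive join with pivot position l:
   [0, i] for b < l, [j, i] for b = l, and [0, j - 1] for b > l. *)
Definition lower (j l b : nat) : nat := if b == l then j else 0.
Definition upper (i j l b : nat) : nat := if b <= l then i else j.-1.

Definition semi_naive_rel (r : rule) (i j l : nat)
    (b : 'I_(size (idb_atoms P r))) : set atom :=
  Delta_range (pred_of (idb_atom b)) (lower j l b) (upper i j l b).

Definition tmp (r : rule) (i : nat) : set atom :=
  [set f |
    (never_applied r i /\
       derived (r := r) (fun b => Delta_range (pred_of (idb_atom b)) 0 i) f)
    \/ exists j (l : 'I_(size (idb_atoms P r))),
         last_applied r i j /\ derived (semi_naive_rel (r := r) i j l) f].

(* N steps of one-rule-per-step semi-naive evaluation of P over I have been
   performed, applying [rule_at 1], ..., [rule_at N]. *)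
Definition semi_naive_evaluation (N : nat) : Prop :=
  [/\ forall i, 1 <= i <= N -> rule_at i \in P,
      forall p, Delta 0 p = set0
    & forall i, i < N -> forall p,
        Delta i.+1 p =
          if p == pred_of (head (rule_at i.+1))
          then tmp (rule_at i.+1) i `\` Delta_range p 0 i
          else set0].

End Evaluation.

(* Main.v *)
(* A fact of Delta^o is a ground instance of the head of rule[o].  If a
   substitution s of J sent q_k(s_k) into Delta^o, then its restriction to the
   variables of R_k would lie in R_k, and s together with the substitution that
   derived the fact would unify q_k(s_k) with the (renamed) head of rule[o]. *)

Require Import Defs.
From mathcomp Require Import all_boot finmap.
From mathcomp Require Import boolp classical_sets functions cardinality.

Set Implicit Arguments.
Unset Strict Implicit.
Unset Printing Implicit Defensive.

Local Open Scope classical_set_scope.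

Section Substitutions.
Variables (Const Var Pred : choiceType) (arity : Pred -> nat).
Local Notation atom := (atom Const Var arity).
Local Notation rule := (rule Const Var arity).
Local Notation substitution := (substitution Const Var).
Implicit Types (s t u : substitution) (a : atom) (r : rule).

Lemma mem_atom_vars a x : (inr x \in args a) = (x \in atom_vars a).
Proof.
rewrite /atom_vars; elim: (args a) => //= -[c|y] ts IH.
  by rewrite in_cons IH.
by rewrite !in_cons IH.
Qed.

Lemma eq_in_subst_atom s u a :
  {in atom_vars a, s =1 u} -> subst_atom s a = subst_atom u a.
Proof.
move=> su; congr (Tagged _ _); apply: val_inj; apply/eq_in_map => -[c //|x].
by rewrite mem_atom_vars => /= /su ->.
Qed.

Lemma subst_atom_comp t s u a :
  {in atom_vars a, forall x,
     subst_term t (subst_term s (inr x)) = subst_term u (inr x)} ->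
  subst_atom t (subst_atom s a) = subst_atom u a.
Proof.
move=> tsu; congr (Tagged _ _); apply: val_inj; rewrite /= -map_comp.
by apply/eq_in_map => -[c //|x]; rewrite mem_atom_vars => /tsu.
Qed.

Lemma mem_atoms_vars (es : seq atom) a x :
  a \in es -> x \in atom_vars a -> x \in atoms_vars es.
Proof. by move=> aes xa; apply/flatten_mapP; exists a. Qed.

Lemma sub_atoms_vars (es es' : seq atom) :
  {subset es <= es'} -> {subset atoms_vars es <= atoms_vars es'}.
Proof.
by move=> sub x /flatten_mapP[a aes]; apply: mem_atoms_vars; apply: sub.
Qed.

Definition restrict (xs : seq Var) s : substitution :=
  fun x => if x \in xs then s x else None.

Lemma subst_atom_restrict (xs : seq Var) s a :
  {subset atom_vars a <= xs} -> subst_atom (restrict xs s) a = subst_atom s a.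
Proof. by move=> sub; apply: eq_in_subst_atom => x /sub; rewrite /restrict => ->. Qed.

(** Membership in [join] prescribes the domain of a substitution exactly, so a member of a longer
    join must be cut down to the variables of the shorter one; the atoms kept see only variables on
    which nothing changed. *)
Lemma join_restrict (I : {fset atom}) (es : seq atom) (m : nat)
    (q : 'I_m -> atom) (D : 'I_m -> set atom) (h h' : nat) s :
  h' <= h -> join I es q D h s ->
  join I es q D h'
    (restrict (atoms_vars (es ++ [seq q b | b : 'I_m <- enum 'I_m & b < h'])) s).
Proof.
move=> le_h [s_const s_es s_D]; split.
- move=> x; rewrite /restrict; case: ifP => xes'; rewrite xes' //.
  have := s_const x; suff -> : x \in atoms_vars
    (es ++ [seq q b | b : 'I_m <- enum 'I_m & b < h]) by [].
  apply: (sub_atoms_vars _ xes') => a; rewrite !mem_cat => /orP[-> //|].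
  case/mapP => b; rewrite mem_filter => /andP[bh' benum] ->.
  by rewrite map_f ?orbT // mem_filter (leq_trans bh' le_h).
- move=> e ees; rewrite subst_atom_restrict; first exact: s_es.
  by move=> x; apply: mem_atoms_vars; rewrite mem_cat ees.
- move=> b bh'; rewrite subst_atom_restrict.
    exact/s_D/(leq_trans bh').
  move=> x; apply: mem_atoms_vars.
  by rewrite mem_cat map_f ?orbT // mem_filter bh' mem_enum.
Qed.

Lemma fresh_seq (xs : seq Var) (n : nat) : infinite_set [set: Var] ->
  exists ys : seq Var, [/\ size ys = n, uniq ys & all [predC xs] ys].
Proof.
move=> Vinf; elim: n => [|n [ys [ysn ysU ysxs]]]; first by exists [::].
have [y yF] : exists y, y \notin xs ++ ys.
  apply: contrapT => noy; apply: Vinf.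
  apply: (sub_finite_set _ (finite_seq (xs ++ ys))) => y _ /=.
  by apply: contrapT => /negP yF; apply: noy; exists y.
move: yF; rewrite mem_cat negb_or => /andP[yxs yys].
by exists (y :: ys); rewrite /= ysn ysU yys ysxs yxs.
Qed.

Lemma renames_apart_ex r' r : infinite_set [set: Var] ->
  exists rho, renames_apart rho r' r.
Proof.
move=> Vinf.
have [ys [ysn ysU /allP ysr]] :=
  fresh_seq (rule_vars r) (size (rule_vars r')) Vinf.
(* [index] picks the first occurrence, so repetitions in [rule_vars r'] do no harm. The default [x]
   of [nth] is never reached on the variables of [r']. *)
exists (fun x => nth x ys (index x (rule_vars r'))); split.
  move=> x y xr' yr' /eqP; rewrite (set_nth_default x y) ?ysn ?index_mem //.
  by rewrite nth_uniq ?ysn ?index_mem // => /eqP; apply: index_inj.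
by move=> x xr'; apply/ysr/mem_nth; rewrite ysn index_mem.
Qed.

(** Renaming makes the variables of the two atoms disjoint, so [s] and [t] can be glued into one
    unifier. The partial substitution [u] costs nothing: where it is defined it already agrees with
    [s], and elsewhere the unifier completes it. *)
Lemma unifies_with_headP r r' a s u t : infinite_set [set: Var] ->
  {subset atom_vars a <= rule_vars r} ->
  {in atom_vars a, forall x, u x = None \/ exists2 c, u x = Some (inl c)
                                          & s x = Some (inl c)} ->
  subst_atom s a = subst_atom t (Defs.head r') ->
  unifies_with_head r (subst_atom u a) r'.
Proof.
move=> Vinf ar us sat; have [rho rhoP] := renames_apart_ex r' r Vinf.
exists rho => //; have [rho_inj rho_r] := rhoP.
pose vs := rule_vars r'.
(* On renamed variables [theta] undoes [rho] by looking up the position of [y] and then applies [t];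
   on all others it is [s]. *)
pose theta : substitution := fun y =>
  if y \in map rho vs
  then Some (subst_term t (inr (nth y vs (index y (map rho vs))))) else s y.
exists theta; transitivity (subst_atom s a).
  apply: subst_atom_comp => x xa /=.
  have [ux|[c -> ->]] := us x xa; last by [].
  (* A variable left free by [u] belongs to [r], hence is not a renamed one, and [theta] treats it
     as [s] does. *)
  rewrite ux /= /theta ifF //; apply/negP => /mapP[y yr' xy].
  by have := rho_r y yr'; rewrite -xy ar.
rewrite sat; apply/esym/subst_atom_comp => x xh /=.
have xvs : x \in vs by rewrite /vs /rule_vars /atoms_vars /= mem_cat xh.
rewrite /theta map_f //=; set y := nth _ _ _.
suff -> : y = x by [].
have ilt : index (rho x) (map rho vs) < size vs.
  by rewrite -(size_map rho) index_mem map_f.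
apply: rho_inj => //; first exact: mem_nth.
by rewrite -(nth_map _ (rho x)) // nth_index // map_f.
Qed.

End Substitutions.

(** Both clauses of [tmp] produce only instances of the head. At [o = 0], where [rule_at] is
    meaningless, [Delta] is empty. *)
Lemma Delta_head_instance (Const Var Pred : choiceType) (arity : Pred -> nat)
    (P : {fset rule Const Var arity}) (I : {fset atom Const Var arity})
    (rule_at : nat -> rule Const Var arity)
    (Delta : nat -> Pred -> set (atom Const Var arity))
    (N o : nat) (p : Pred) (f : atom Const Var arity) :
  semi_naive_evaluation P I rule_at Delta N -> o <= N -> Delta o p f ->
  exists t, f = subst_atom t (Defs.head (rule_at o)).
Proof.
case=> _ Delta0 DeltaS; case: o => [_|o oN]; first by rewrite Delta0.
rewrite DeltaS //; case: ifP => // _ [+ _].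
by case=> [[_ [_ [t [-> _ _]]]]|[j [l [_ [_ [t [-> _ _]]]]]]]; exists t.
Qed.

Theorem theorem2 (Const Var Pred : choiceType) (arity : Pred -> nat)
    (Var_infinite : infinite_set [set: Var])
    (P : {fset rule Const Var arity}) (I : {fset atom Const Var arity})
    (HP : datalog_program P) (HI : database_instance P I)
    (rule_at : nat -> rule Const Var arity)
    (Delta : nat -> Pred -> set (atom Const Var arity))
    (i : nat) (Heval : semi_naive_evaluation P I rule_at Delta i)
    (r : rule Const Var arity) (Hr : r \in P) (Hnext : rule_at i.+1 = r)
    (j : nat) (Hj : last_applied rule_at r i j)
    (l k : 'I_(size (idb_atoms P r))) (o : nat)
    (Ho : lower j l k <= o <= upper i j l k)
    (Hne : Delta o (pred_of (idb_atom k)) !=set0)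
    (Hnounif :
      forall s : substitution Const Var,
        join I (edb_atoms P r) (@idb_atom _ _ _ _ P r)
          (semi_naive_rel Delta i j l) k s ->
        ~ unifies_with_head r (subst_atom s (idb_atom k)) (rule_at o)) :
  join I (edb_atoms P r) (@idb_atom _ _ _ _ P r)
    (fun b => if b == k
              then semi_naive_rel Delta i j l b `\` Delta o (pred_of (idb_atom k))
              else semi_naive_rel Delta i j l b)
    (size (idb_atoms P r))
  = join I (edb_atoms P r) (@idb_atom _ _ _ _ P r)
      (semi_naive_rel Delta i j l) (size (idb_atoms P r)).
Proof.
apply/seteqP; split=> s [s_const s_es s_D]; split=> // b bm.
  by have := s_D b bm; case: ifP => // _ [].
(* Shrinking one relation can only lose substitutions, so what remains is that no member of the
   original join sends its [k]-th atom into [Delta o]. *)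
case: eqP => [-> {b bm}|_]; last exact: s_D.
split=> [|Dos]; first exact: s_D.
(* The evaluation is specified only up to step [i]; for [k > l] the upper bound is [j - 1], which is
   below [i]. *)
have oi : o <= i.
  have [/andP[_ ji] _ _] := Hj; have /andP[_] := Ho; rewrite /upper.
  case: ifP => // _ /leq_trans; apply; exact: leq_trans (leq_pred j) ji.
have [t st] := Delta_head_instance Heval oi Dos.
apply: Hnounif (join_restrict (ltnW (ltn_ord k)) (And3 s_const s_es s_D)) _.
have k_body : idb_atom k \in idb_atoms P r by exact: mem_tnth.
have k_vars : {subset atom_vars (idb_atom k) <= rule_vars r}.
  move=> x; apply: mem_atoms_vars; rewrite in_cons; apply/orP; right.
  by move: k_body; rewrite mem_filter => /andP[].
apply: (unifies_with_headP Var_infinite k_vars _ st) => x xk.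
(* A variable of the [k]-th atom either is bound by an earlier atom, and then [s] gives it a
   constant, or is left free by the restriction. *)
rewrite /restrict; case: ifP => _; [right|by left].
have := s_const x; rewrite (@mem_atoms_vars _ _ _ _ _ (idb_atom k)) //.
  by case=> c sx; exists c.
by rewrite mem_cat map_f ?orbT // mem_filter ltn_ord mem_enum.
Qed.
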